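(* There is a universal constant $C>0$ such that the following holds. Let $p\geq 1$ and $d\geq 2$, let $\mu$ be a Borel probability measure on $\mathbb{R}^d$ with finite $p$th moment, and let $\nu$ be a Borel probability measure on $\mathbb{R}^d$ whose support $\mathcal{Y}$ is a countable (closed) set. Suppose that there exists a coupling $\gamma\in\Gamma(\mu,\nu)$ such that $$\|x-y\| = d(x,\mathcal{Y}) \quad\text{for } \gamma\text{-a.e. } (x,y).$$ Then $$W_p(\mu,\nu) \leq C\sqrt{d}\, K_{\mu,\nu}\, SW_{p,1}(\mu,\nu).$$
   Context: $\|\cdot\|$ is the Euclidean norm, $d(x,\mathcal{Y}) := \min_{y\in\mathcal{Y}}\|x-y\|$, and $\Gamma(\mu,\nu)$ is the set of couplings of $\mu$ and $\nu$ (probability measures on the product space with marginals $\mu$ and $\nu$). The $p$-Wasserstein distance is $W_p(\mu,\nu) := \big(\inf_{\gamma\in\Gamma(\mu,\nu)}\int \|x-y\|^p\,d\gamma(x,y)\big)^{1/p}$ (on $\mathbb{R}^d$ or on $\mathbb{R}$). The sliced Wasserstein distance is $$SW_{p,1}(\mu,\nu) := \Big(\int_{\mathbb{S}^{d-1}} W_p^p(\theta_\#\mu,\theta_\#\nu)\,d\sigma_d(\theta)\Big)^{1/p},$$ where $\theta_\#\mu$ is the pushforward of $\mu$ under $x\mapsto\langle\theta,x\rangle$ and $\sigma_d$ is the uniform probability measure on $\mathbb{S}^{d-1}$. The complexity parameter is $$K_{\mu,\nu} := \operatorname*{ess\,sup}_{x\sim\mu,\; x\notin\mathcal{Y}} \;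 d(x,\mathcal{Y})\sum_{y\in\mathcal{Y}}\frac{1}{\|x-y\|} \in [1,\infty],$$ (the $\mu$-essential supremum over $x\notin\mathcal{Y}$), with the convention $K_{\mu,\nu}:=1$ if $\mu(\mathcal{Y})=1$. If $K_{\mu,\nu}=\infty$ the bound is regarded as trivially true. *)

(* Defs.v *)
From mathcomp Require Import all_boot all_order all_algebra.
From mathcomp Require Import all_classical all_reals all_analysis.
From mathcomp Require Import ess_sup_inf.

Set Implicit Arguments.
Unset Strict Implicit.
Unset Printing Implicit Defensive.

Import Order.TTheory GRing.Theory Num.Theory.
Import numFieldNormedType.Exports.

Local Open Scope classical_set_scope.
Local Open Scope ring_scope.

(* R^d with its Borel sigma-algebra; the topology on row vectors is the product
   topology, i.e. the Euclidean one. *)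
Notation borelRV R d := (g_sigma_algebraType (@open 'rV[R]_d)).

Definition dotrv (R : realType) (d : nat) (x y : 'rV[R]_d) : R :=
  \sum_(i < d) x ord0 i * y ord0 i.

(* The library norm `|x| on 'rV[R]_d is the sup norm, hence this definition. *)
Definition enorm (R : realType) (d : nat) (x : 'rV[R]_d) : R :=
  Num.sqrt (dotrv x x).

(* d(x, Y); the infimum is attained when Y is closed and nonempty. *)
Definition dist_set (R : realType) (d : nat) (x : 'rV[R]_d)
    (Y : set 'rV[R]_d) : R :=
  inf [set enorm (x - y) | y in Y].

Definition msupport (R : realType) (d : nat)
    (nu : probability (borelRV R d) R) : set 'rV[R]_d :=
  [set x | forall U : set 'rV[R]_d, open U -> U x -> (0 < nu U)%E].

(* The marginals are plain set functions, so that the pushforwards below can be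
   used without carrying measurability proofs. *)
Definition coupling (R : realType) (disp : measure_display)
    (T : measurableType disp) (mu nu : set T -> \bar R)
    (gamma : probability (T * T)%type R) : Prop :=
  forall A : set T, measurable A ->
    pushforward gamma fst A = mu A /\ pushforward gamma snd A = nu A.

Definition Wasserstein (R : realType) (disp : measure_display)
    (T : measurableType disp) (dist : T -> T -> R) (p : R)
    (mu nu : set T -> \bar R) : \bar R :=
  (ereal_inf [set \int[gamma]_z ((dist z.1 z.2) `^ p)%:E
             | gamma in [set gamma : probability (T * T)%type R
                        | coupling mu nu gamma]] `^ p^-1)%E.

Definition Wp (R : realType) (d : nat) (p : R)
    (mu nu : set (borelRV R d) -> \bar R) : \bar R :=
  @Wasserstein R _ (borelRV R d) (fun x y : 'rV[R]_d => enorm (x - y)) p mu nu.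

Definition Wp1 (R : realType) (p : R)
    (mu nu : set (measurableTypeR R) -> \bar R) : \bar R :=
  @Wasserstein R _ (measurableTypeR R) (fun s t : R => `|s - t|) p mu nu.

Definition sphere (R : realType) (d : nat) : set 'rV[R]_d :=
  [set theta | enorm theta = 1].
Arguments sphere : clear implicits.

(* The uniform probability measure on the unit sphere, seen as a measure on R^d:
   the unique Borel probability measure that is concentrated on the sphere and
   invariant under the orthogonal group. *)
Definition uniform_on_sphere (R : realType) (d : nat)
    (sigma : probability (borelRV R d) R) : Prop :=
  sigma (sphere R d) = 1%E /\
  forall Q : 'M[R]_d, Q *m Q^T = 1%:M ->
  forall A : set (borelRV R d), measurable A ->
    pushforward sigma (fun x : 'rV[R]_d => x *m Q : borelRV R d) A = sigma A.

Definition slice_pushforward (R : realType) (d : nat) (theta : 'rV[R]_d)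
    (mu : set (borelRV R d) -> \bar R) : set (measurableTypeR R) -> \bar R :=
  pushforward mu (fun x : borelRV R d => dotrv theta x : measurableTypeR R).

Definition SW (R : realType) (d : nat) (sigma : probability (borelRV R d) R)
    (p : R) (mu nu : set (borelRV R d) -> \bar R) : \bar R :=
  ((\int[sigma]_(theta in sphere R d)
      (Wp1 p (slice_pushforward theta mu) (slice_pushforward theta nu)) `^ p) `^ p^-1)%E.

(* K_{mu,nu} with Y the support of nu. The value -oo on Y discards the points of
   Y from the essential supremum. *)
Definition Kparam (R : realType) (d : nat) (mu nu : probability (borelRV R d) R)
    : \bar R :=
  let Y := msupport nu in
  if mu Y == 1%E then 1%E else
  ess_sup mu (fun x : borelRV R d =>
    if x \in Y then -oo%E else
    ((dist_set x Y)%:E * \esum_(y in Y) ((enorm (x - y : 'rV[R]_d))^-1)%:E)%E).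

(* Main.v *)
(** The given coupling shows [W_p^p <= int d(x,Y)^p dmu].  In a direction
    [theta], every coupling of the projections costs at least the integral of
    the p-th power of the distance from [<theta,x>] to [<theta,Y>].  For a unit
    vector [u], the strip [|<theta,u>| <= e] has measure at most [6 sqrt d e],
    so by the union bound over [y] the distance from [<theta,x>] to
    [<theta,Y>] exceeds [d(x,Y) / (12 sqrt d K)] for at least half of the
    directions; Tonelli's theorem concludes.

    The strip estimate uses only rotation invariance.  Let [H] be the Huber
    function, with [H'' = 1] on [[-2e,2e]] and [H'' = 0] elsewhere.  Rotating
    the coordinate [theta_0] towards [theta_j] by the angles [+a] and [-a]
    leaves the integral of [H(theta_0)] unchanged, and its second-order
    expansion in [a] bounds [int theta_j^2 1(|theta_0| <= e)] by a multiple of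
    [e int |theta_0| <= e / sqrt d].  Summing over [j] replaces [theta_j^2] by
    [1 - theta_0^2], which is close to [1] on the strip. *)

Require Import Defs.
From HB Require Import structures.
From mathcomp Require Import all_boot all_order all_algebra.
From mathcomp Require Import all_classical all_reals all_analysis.
From mathcomp Require Import measurable_realfun ess_sup_inf ring lra.

Set Implicit Arguments.
Unset Strict Implicit.
Unset Printing Implicit Defensive.

Import Order.TTheory GRing.Theory Num.Theory.
Import numFieldNormedType.Exports.

Local Open Scope classical_set_scope.
Local Open Scope ring_scope.

(** * Euclidean geometry of row vectors *)

(** Rotation invariance and the marginal conditions of a coupling are both equalities of laws on
    measurable sets. This turns them into equalities of integrals: each side is the integral of [f]
    against its image law, and the two image laws agree. *)
Lemma ge0_integral_image d1 d2 d3 (X1 : measurableType d1)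
    (X2 : measurableType d2) (Y : measurableType d3) (R : realType)
    (phi1 : X1 -> Y) (phi2 : X2 -> Y) (m1 : {measure set X1 -> \bar R})
    (m2 : {measure set X2 -> \bar R}) (f : Y -> \bar R) :
  measurable_fun setT phi1 -> measurable_fun setT phi2 ->
  (forall A, measurable A -> pushforward m1 phi1 A = pushforward m2 phi2 A) ->
  measurable_fun setT f -> (forall y, 0 <= f y)%E ->
  (\int[m1]_x f (phi1 x) = \int[m2]_x f (phi2 x))%E.
Proof.
move=> mphi1 mphi2 m12 mf f0.
pose g1 : {mfun X1 >-> Y} := HB.pack phi1 (isMeasurableFun.Build _ _ _ _ _ mphi1).
pose g2 : {mfun X2 >-> Y} := HB.pack phi2 (isMeasurableFun.Build _ _ _ _ _ mphi2).
transitivity (\int[pushforward m1 g1]_y f y)%E.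
  by rewrite ge0_integral_pushforward.
rewrite (eq_measure_integral (pushforward m2 g2)).
  by rewrite ge0_integral_pushforward.
by move=> A mA _; exact: m12.
Qed.

Section dot.
Variables (R : realType) (d : nat).
Implicit Types x y z u v w : 'rV[R]_d.

Lemma dotrv_mx x y : dotrv x y = (x *m y^T) ord0 ord0.
Proof. by rewrite mxE; apply: eq_bigr => i _; rewrite mxE. Qed.

Lemma dotrvC x y : dotrv x y = dotrv y x.
Proof. by apply: eq_bigr => i _; rewrite mulrC. Qed.

Lemma dotrvDr x y z : dotrv x (y + z) = dotrv x y + dotrv x z.
Proof. by rewrite -big_split; apply: eq_bigr => i _; rewrite mxE mulrDr. Qed.

Lemma dotrvDl x y z : dotrv (y + z) x = dotrv y x + dotrv z x.
Proof. by rewrite dotrvC dotrvDr !(dotrvC x). Qed.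

Lemma dotrvZr x y (a : R) : dotrv x (a *: y) = a * dotrv x y.
Proof. by rewrite mulr_sumr; apply: eq_bigr => i _; rewrite mxE mulrCA. Qed.

Lemma dotrvZl x y (a : R) : dotrv (a *: y) x = a * dotrv y x.
Proof. by rewrite dotrvC dotrvZr dotrvC. Qed.

Lemma dotrvBr x y z : dotrv x (y - z) = dotrv x y - dotrv x z.
Proof. by rewrite -scaleN1r dotrvDr dotrvZr mulN1r. Qed.

Lemma dotrvBl x y z : dotrv (y - z) x = dotrv y x - dotrv z x.
Proof. by rewrite dotrvC dotrvBr !(dotrvC x). Qed.

Lemma dotrv_delta x i : dotrv x (delta_mx ord0 i) = x ord0 i.
Proof.
rewrite /dotrv (bigD1 i)//= mxE !eqxx mulr1 big1 ?addr0// => j /negPf ji.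
by rewrite mxE ji andbF mulr0.
Qed.

Lemma dotrv_ge0 x : 0 <= dotrv x x.
Proof. by apply: sumr_ge0 => i _; rewrite -expr2 sqr_ge0. Qed.

Lemma dotrv_eq0 x : (dotrv x x == 0) = (x == 0).
Proof.
apply/idP/idP => [|/eqP->]; last by rewrite /dotrv big1// => i; rewrite mxE mulr0.
rewrite psumr_eq0 => [/allP x0|i _]; last by rewrite -expr2 sqr_ge0.
apply/eqP/rowP => i; rewrite mxE; have := x0 i (mem_index_enum _).
by rewrite mulf_eq0 orbb => /eqP.
Qed.

Lemma dotrv_mulmx x y (Q : 'M[R]_d) : dotrv (x *m Q) y = dotrv x (y *m Q^T).
Proof. by rewrite !dotrv_mx trmx_mul trmxK mulmxA. Qed.

Lemma mulmx_outer x y z : x *m (y^T *m z) = dotrv x y *: z.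
Proof.
by rewrite mulmxA [x *m _]mx11_scalar -dotrv_mx mul_scalar_mx.
Qed.

(* A Householder reflection exchanges two vectors of the same length. *)
Lemma reflection_exists u w : dotrv u u = dotrv w w ->
  exists2 Q : 'M[R]_d, Q *m Q^T = 1%:M & w *m Q^T = u.
Proof.
move=> uw; have [->|uNw] := eqVneq u w.
  by exists 1%:M; rewrite trmx1 mulmx1.
pose v := u - w; pose n := dotrv v v.
have n0 : n != 0 by rewrite dotrv_eq0 subr_eq0.
pose Q := 1%:M - (2 / n) *: (v^T *m v).
have QT : Q^T = Q by rewrite /Q linearB/= linearZ/= trmx1 trmx_mul trmxK.
exists Q; rewrite QT.
  have -> : Q *m Q = Q - (2 / n) *: (v^T *m (v *m Q)).
    by rewrite {1}/Q mulmxBl mul1mx -scalemxAl mulmxA.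
  (* Since the reflection negates its own axis [v], it squares to the identity. It is symmetric, so
     it is orthogonal. *)
  have -> : v *m Q = - v.
    rewrite /Q mulmxBr mulmx1 -scalemxAr mulmx_outer scalerA -/n divfK//.
    by rewrite scaler_nat mulr2n opprD addrA subrr add0r.
  by rewrite mulmxN scalerN opprK /Q subrK.
rewrite /Q mulmxBr mulmx1 -scalemxAr mulmx_outer scalerA.
have wv : dotrv w v = - (n / 2).
  by rewrite /n /v dotrvBl !dotrvBr (dotrvC u w) -uw; lra.
by rewrite wv mulrN mulrA divfK// divff ?pnatr_eq0// scaleN1r opprK addrC subrK.
Qed.

Lemma enorm_ge0 x : 0 <= enorm x. Proof. exact: sqrtr_ge0. Qed.

Lemma sqr_enorm x : enorm x ^+ 2 = dotrv x x.
Proof. by rewrite sqr_sqrtr// dotrv_ge0. Qed.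

Lemma enorm_eq0 x : (enorm x == 0) = (x == 0).
Proof. by rewrite -(sqrf_eq0 (enorm x)) sqr_enorm dotrv_eq0. Qed.

Lemma dotrv_le x y : `|dotrv x y| <= enorm x * enorm y.
Proof.
rewrite -(@ler_pXn2r _ 2)// ?nnegrE ?mulr_ge0 ?enorm_ge0//.
rewrite exprMn !sqr_enorm -normrX ger0_norm ?sqr_ge0//.
have [->|y0] := eqVneq y 0.
  by rewrite -(scale0r 0) !dotrvZr !mul0r mulr0 expr0n.
have yy : 0 < dotrv y y by rewrite lt_def dotrv_eq0 y0 dotrv_ge0.
(* Cauchy-Schwarz: this squared norm expands to [c * (a * c - b ^+ 2)], and [c] is positive. *)
have := dotrv_ge0 (dotrv y y *: x - dotrv x y *: y).
rewrite dotrvBl !dotrvBr !dotrvZl !dotrvZr (dotrvC y x).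
set a := dotrv x x; set b := dotrv x y; set c := dotrv y y in yy * => h.
have : 0 <= c * (a * c - b ^+ 2) by nra.
by rewrite pmulr_rge0// subr_ge0.
Qed.

End dot.

(** * Borel sets and measurable maps *)

(** The cubes with rational centre and radius [1 / (k + 1)] form a countable base of the topology.
    This serves both for Borel measurability and for showing that the complement of a support is
    null. *)
Definition rat_box (R : realType) d (qk : 'rV[rat]_d * nat) : set 'rV[R]_d :=
  [set x | forall i, `|x ord0 i - ratr (qk.1 ord0 i)| < qk.2.+1%:R^-1].

Lemma rat_box_nbhs (R : realType) d (U : set 'rV[R]_d) x : nbhs x U ->
  exists2 qk, rat_box qk x & rat_box qk `<=` U.
Proof.
move=> /nbhs_ballP[e /= e0 eU].
(* Half the radius suffices: any two points of a cube of radius [r] differ by less than [2 * r] in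
   each coordinate. *)
have [k ke] : exists k : nat, k.+1%:R^-1 < e / 2.
  have [k _ kP] := near_infty_natSinv_lt (PosNum (divr_gt0 e0 (ltr0Sn _ 1))).
  by exists k; exact: (kP k (leqnn k)).
set r : R := k.+1%:R^-1 in ke; have r0 : 0 < r by rewrite invr_gt0.
have /choice[q qP] i : exists q : rat, `|x ord0 i - ratr q| < r.
  have [|q] := @rat_in_itvoo R (x ord0 i - r) (x ord0 i + r); first by lra.
  by rewrite in_itv/= => /andP[? ?]; exists q; rewrite ltr_distlC; lra.
exists (\row_i q i, k) => [i|y yP]; rewrite /= ?mxE//.
apply: eU; split => // i j; rewrite ord1.
rewrite -ball_normE/=; have := yP j; have := qP j; rewrite /= mxE -[_.+1%:R^-1]/r.
by rewrite !ltr_distlC => /andP[? ?] /andP[? ?]; apply/andP; split; lra.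
Qed.

Lemma measurable_preimage_rat_box dT (T : measurableType dT) (R : realType) d
    (f : T -> 'rV[R]_d) qk :
  (forall i, measurable_fun setT (fun t => f t ord0 i)) ->
  measurable (f @^-1` rat_box qk).
Proof.
move=> mf.
have -> : f @^-1` rat_box qk = \bigcap_(i in [set: 'I_d])
    [set t | `|f t ord0 i - ratr (qk.1 ord0 i)| < qk.2.+1%:R^-1].
  by apply/seteqP; split => t h i; [move=> _; exact: h|exact: (h i)].
apply: fin_bigcap_measurable => // i _.
rewrite -[X in measurable X]setTI.
have : measurable_fun setT
    (fun t => `|f t ord0 i - ratr (qk.1 ord0 i)|).
  by apply: measurableT_comp => //; exact: measurable_funB.
move=> /(_ measurableT `]-oo, qk.2.+1%:R^-1[%classic (measurable_itv _)).
by rewrite !setTI; congr (measurable _); apply/seteqP; split => t /=;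
  rewrite in_itv.
Qed.

(** An open set is the countable union of the rational boxes it contains, and the preimage of a box
    is a finite intersection of conditions on single coordinates. *)
Lemma measurable_fun_borelRV dT (T : measurableType dT) (R : realType) d
    (f : T -> borelRV R d) :
  (forall i, measurable_fun setT (fun t => (f t : 'rV[R]_d) ord0 i)) ->
  measurable_fun setT f.
Proof.
move=> mf; apply: (@measurability _ _ T (borelRV R d) setT f (@open 'rV[R]_d)) => // _ [U oU <-].
rewrite setTI.
have -> : f @^-1` U = \bigcup_(qk : 'rV[rat]_d * nat)
    (if `[< rat_box qk `<=` U >] then f @^-1` rat_box qk else set0).
  apply/seteqP; split => [t /= ft|t [qk _]].
    have [qk ? ?] := rat_box_nbhs (open_nbhs_nbhs (conj oU ft)).
    by exists qk => //; case: asboolP.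
  by case: asboolP => //; apply.
apply: countable_bigcupT_measurable => [|qk]; first exact: countableP.
case: ifP => // _.
exact: measurable_preimage_rat_box.
Qed.

Lemma continuous_measurable_borelRV (R : realType) d (f : 'rV[R]_d -> R) :
  continuous f -> measurable_fun setT (f : borelRV R d -> R).
Proof.
move=> /continuousP cf; apply: (measurability _ (RGenOpens.measurableE R)).
move=> _ [_ [a [b ->]] <-]; rewrite setTI; apply: sub_sigma_algebra.
by apply: (cf `]a, b[%classic); exact: interval_open.
Qed.

Lemma measurable_coord (R : realType) d (i : 'I_d) :
  measurable_fun setT (fun x : borelRV R d => (x : 'rV[R]_d) ord0 i).
Proof.
exact: (continuous_measurable_borelRV (@coord_continuous R 1 d ord0 i)).
Qed.

Lemma measurable_rat_box (R : realType) d qk :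
  measurable (rat_box qk : set (borelRV R d)).
Proof. exact: (measurable_preimage_rat_box _ (@measurable_coord R d)). Qed.

Lemma measurable_fun_coord dT (T : measurableType dT) (R : realType) d
    (f : T -> borelRV R d) i : measurable_fun setT f ->
  measurable_fun setT (fun t => (f t : 'rV[R]_d) ord0 i).
Proof. by move=> mf; exact: (measurableT_comp (@measurable_coord R d i) mf). Qed.

Lemma measurable_fun_dotrv dT (T : measurableType dT) (R : realType) d
    (f g : T -> borelRV R d) :
  measurable_fun setT f -> measurable_fun setT g ->
  measurable_fun setT (fun t => dotrv (f t) (g t)).
Proof.
move=> mf mg; apply: measurable_sum => i.
by apply: measurable_funM; exact: measurable_fun_coord.
Qed.

Lemma measurable_fun_subrv dT (T : measurableType dT) (R : realType) d
    (f g : T -> borelRV R d) :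
  measurable_fun setT f -> measurable_fun setT g ->
  measurable_fun setT (fun t => (f t : 'rV[R]_d) - g t : borelRV R d).
Proof.
move=> mf mg; apply: measurable_fun_borelRV => i.
rewrite (_ : (fun t => _) = (fun t => (f t : 'rV[R]_d) ord0 i - (g t : 'rV[R]_d) ord0 i)).
  by apply: measurable_funB; exact: measurable_fun_coord.
by apply/funext => t; rewrite !mxE.
Qed.

Lemma measurable_fun_enorm dT (T : measurableType dT) (R : realType) d
    (f : T -> borelRV R d) :
  measurable_fun setT f -> measurable_fun setT (fun t => enorm (f t)).
Proof.
move=> mf.
exact: (measurableT_comp (continuous_measurable_fun (@sqrt_continuous R))
  (measurable_fun_dotrv mf mf)).
Qed.

Lemma measurable_mulmxr (R : realType) d (Q : 'M[R]_d) :
  measurable_fun setT (fun x : borelRV R d => (x : 'rV[R]_d) *m Q : borelRV R d).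
Proof.
apply: measurable_fun_borelRV => i.
rewrite (_ : (fun t => _) = (fun t : borelRV R d => \sum_j (t : 'rV[R]_d) ord0 j * Q j i)).
  apply: measurable_sum => j; apply: measurable_funM => //.
  exact: measurable_coord.
by apply/funext => t; rewrite !mxE.
Qed.

(** * The uniform measure of a strip *)

Section huber.
Variables (R : realType) (e : R).
Hypothesis e0 : 0 <= e.

(** For [0 <= e] this is the maximum of [l * |t| - l ^+ 2 / 2] over [0 <= l <= e], attained at
    [l = min(|t|, e)]. It equals [t ^+ 2 / 2] on [[-e, e]] and is affine in [|t|] outside. The dual
    form gives lower bounds with any slope [l]. *)
Definition huber (t : R) : R :=
  let m := Num.min `|t| e in m * `|t| - m ^+ 2 / 2.

Lemma huber_small t : `|t| <= e -> huber t = t ^+ 2 / 2.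
Proof.
by move=> te; rewrite /huber /= min_l// -(real_normK (num_real t)); lra.
Qed.

Lemma huber_ge t l : 0 <= l -> l <= e -> l * `|t| - l ^+ 2 / 2 <= huber t.
Proof.
move=> l0 le; rewrite /huber /=; case: (leP `|t| e) => te.
  by have := sqr_ge0 (`|t| - l); lra.
have : 0 <= (e - l) * (`|t| - e) by apply: mulr_ge0; lra.
by have := sqr_ge0 (e - l); lra.
Qed.

Lemma huber_ge0 t : 0 <= huber t.
Proof. by have := huber_ge t (lexx 0) e0; rewrite mul0r expr0n/= mul0r subr0. Qed.

Lemma huber_le t : huber t <= e * `|t|.
Proof.
by rewrite /huber /=; have := normr_ge0 t; case: (leP `|t| e) => te t0; nra.
Qed.

(** Here [c] and [s] are the cosine and sine of the angle. Convexity makes the sum of the two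
    rotated values at least [2 * huber a], up to the loss from shrinking [a] to [c * a]. When both
    rotated points stay in the quadratic zone, there is the extra gain [s ^+ 2 * b ^+ 2]. *)
Lemma huber_rotation (c s a b : R) : 0 <= c -> c ^+ 2 + s ^+ 2 = 1 -> 0 <= s ->
  `|b| <= 1 ->
  2 * huber a + s ^+ 2 * b ^+ 2 * (`|a| <= e - s)%R%:R <=
  huber (c * a + s * b) + huber (c * a - s * b) + 2 * (1 - c) * e * `|a|.
Proof.
move=> c0 cs s0 b1; have c1 : c <= 1 by nra.
have a0 := normr_ge0 a; have sb : s * `|b| <= s by nra.
have ca : `|c * a| = c * `|a| by rewrite normrM ger0_norm.
have sbE : `|s * b| = s * `|b| by rewrite normrM (ger0_norm s0).
have [ae|_] := boolP (`|a| <= e - s); last first.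
  rewrite mulr0 addr0.
  (* The slope [m] that is optimal at [a] is used at both rotated points. The triangle inequality
     gives absolute values summing to at least [2 * c * |a|], so the loss is at most
     [2 * (1 - c) * m * |a|]. *)
  set m := Num.min `|a| e.
  have m0 : 0 <= m by rewrite le_min a0.
  have me : m <= e by rewrite ge_min lexx orbT.
  have h1 := huber_ge (c * a + s * b) m0 me.
  have h2 := huber_ge (c * a - s * b) m0 me.
  have := ler_normD (c * a + s * b) (c * a - s * b).
  have -> : c * a + s * b + (c * a - s * b) = (c * a) *+ 2 by rewrite mulr2n; ring.
  rewrite normrMn ca mulr2n => h3.
  rewrite {1}/huber /= -/m.
  have : m * (c * `|a| + c * `|a|) <=
      m * (`|c * a + s * b| + `|c * a - s * b|) by exact: ler_wpM2l.
  have : m * ((1 - c) * `|a|) <= e * ((1 - c) * `|a|).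
    by apply: ler_wpM2r => //; apply: mulr_ge0 => //; lra.
  by lra.
have cae : c * `|a| <= `|a| by nra.
rewrite !huber_small; [| | |lra].
- rewrite mulr1.
  have a2 : a ^+ 2 = `|a| ^+ 2 by rewrite real_normK// num_real.
  (* All three values are now quadratic, and what remains is to absorb [s ^+ 2 * a ^+ 2 = (1 - c) *
     (1 + c) * a ^+ 2], using [|a| <= e] and [c <= 1]. *)
  have : (1 - c) * `|a| * ((1 + c) * `|a|) <= (1 - c) * `|a| * (2 * e).
    by apply: ler_wpM2l; [apply: mulr_ge0 => //; lra|nra].
  have -> : (1 - c) * `|a| * ((1 + c) * `|a|) = s ^+ 2 * a ^+ 2.
    by rewrite a2 -(addrK (c ^+ 2) (s ^+ 2)) (addrC (s ^+ 2)) cs; ring.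
  have -> : (c * a + s * b) ^+ 2 / 2 + (c * a - s * b) ^+ 2 / 2 =
     c ^+ 2 * a ^+ 2 + s ^+ 2 * b ^+ 2 by field.
  have -> : 2 * (a ^+ 2 / 2) = (c ^+ 2 + s ^+ 2) * a ^+ 2 by rewrite cs; field.
  by lra.
- by have := ler_normB (c * a) (s * b); rewrite ca sbE; lra.
- by have := ler_normD (c * a) (s * b); rewrite ca sbE; lra.
Qed.

Lemma measurable_huber : measurable_fun setT huber.
Proof.
have mm : measurable_fun setT (fun t : R => Num.min `|t| e).
  by apply: measurable_minr.
apply: measurable_funB; apply: measurable_funM => //.
exact: measurable_funX.
Qed.

End huber.

Lemma integral_cst_probability dT (T : measurableType dT) (R : realType)
    (P : probability T R) (r : \bar R) : (\int[P]_x r = r)%E.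
Proof.
by rewrite integral_cst// -[RHS]mule1; congr (_ * _)%E; exact: probability_setT.
Qed.

Section uniform_sphere.
Variables (R : realType) (d : nat) (sigma : probability (borelRV R d) R).
Hypothesis sigmaU : uniform_on_sphere sigma.

Lemma measurable_dotrvl (u : 'rV[R]_d) :
  measurable_fun setT (fun x : borelRV R d => dotrv x u).
Proof. exact: (measurable_fun_dotrv (@measurable_id _ _ setT)). Qed.

Lemma measurable_sphere : measurable (sphere R d : set (borelRV R d)).
Proof.
have me := measurable_fun_enorm (@measurable_id _ (borelRV R d) setT).
rewrite [X in measurable X](_ : _ = setT `&` (fun x : borelRV R d => enorm x) @^-1` [set 1]).
  exact: me.
by rewrite setTI.
Qed.

Lemma ae_sphere : {ae sigma, forall x, dotrv x x = 1}.
Proof.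
exists (~` (sphere R d : set (borelRV R d))); split.
- by apply: measurableC; exact: measurable_sphere.
- rewrite probability_setC; last exact: measurable_sphere.
  by rewrite sigmaU.1 subee.
- by move=> x /=; apply: contra_not => /= x1; rewrite -sqr_enorm x1 expr1n.
Qed.

(** The law of [dotrv x u] depends only on the length of [u], because a reflection carries [w] to
    [u] and preserves [sigma]. *)
Lemma uniform_dotrv (u w : 'rV[R]_d) (F : R -> \bar R) : dotrv u u = dotrv w w ->
  measurable_fun setT F -> (forall t, 0 <= F t)%E ->
  (\int[sigma]_x F (dotrv x u) = \int[sigma]_x F (dotrv x w))%E.
Proof.
move=> uw mF F0; have [Q QQ wQ] := reflection_exists uw.
rewrite -(@ge0_integral_image _ _ _ _ _ _ _ _ _ sigma sigma
  (fun x : borelRV R d => F (dotrv x w)) (measurable_mulmxr Q) (@measurable_id _ _ setT))//.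
- by apply: eq_integral => x _; rewrite dotrv_mulmx wQ.
- exact: sigmaU.2.
- exact: (measurableT_comp mF (measurable_dotrvl w)).
Qed.

Lemma ae_dotrv_le1 (u : 'rV[R]_d) : dotrv u u = 1 ->
  {ae sigma, forall x, `|dotrv x u| <= 1}.
Proof.
move=> u1; have FF := ae_filter_ringOfSetsType sigma.
apply: (@filterS _ _ FF _ _ _ ae_sphere) => x x1.
by have := dotrv_le x u; rewrite /enorm x1 u1 sqrtr1 mulr1.
Qed.

Section coordinates.
Variable i0 : 'I_d.
Notation basis i := (delta_mx ord0 i : 'rV[R]_d).

Lemma dotrv_basis i j : dotrv (basis i) (basis j) = (i == j)%:R.
Proof. by rewrite dotrv_delta mxE eqxx eq_sym. Qed.

(** By invariance all coordinates have the same second moment, and their squares sum to [1] on the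
    sphere. *)
Lemma uniform_second_moment :
  (d%:R%:E * \int[sigma]_x ((x : 'rV[R]_d) ord0 i0 ^+ 2)%:E = 1)%E.
Proof.
transitivity (\sum_(j < d) \int[sigma]_x ((x : 'rV[R]_d) ord0 j ^+ 2)%:E)%E.
  rewrite (eq_bigr (fun=> \int[sigma]_x ((x : 'rV[R]_d) ord0 i0 ^+ 2)%:E)%E).
    rewrite mule_natl big_const_ord; move: (integral _ _ _) => I.
    by elim: (d) => [|n IH] //; rewrite muleS IH.
  move=> j _; transitivity (\int[sigma]_x (dotrv x (basis j) ^+ 2)%:E)%E.
    by apply: eq_integral => x _; rewrite dotrv_delta.
  rewrite (@uniform_dotrv _ (basis i0) (fun t => (t ^+ 2)%:E)).
  - by apply: eq_integral => x _; rewrite dotrv_delta.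
  - by rewrite !dotrv_basis !eqxx.
  - exact/measurable_EFinP/measurable_funX.
  - by move=> t; rewrite lee_fin sqr_ge0.
have mx j : measurable_fun setT
    (fun x : borelRV R d => ((x : 'rV[R]_d) ord0 j ^+ 2)%:E).
  by apply/measurable_EFinP/measurable_funX; exact: measurable_coord.
rewrite -ge0_integral_sum//; last by move=> *; rewrite lee_fin sqr_ge0.
rewrite (ae_eq_integral (cst 1%E))//.
- exact: integral_cst_probability.
- exact: emeasurable_sum.
- have FF := ae_filter_ringOfSetsType sigma.
  apply: (@filterS _ _ FF _ _ _ ae_sphere) => x x1 _ /=; rewrite sumEFin -x1.
  by congr _%:E; apply: eq_bigr => i _; rewrite expr2.
Qed.

Lemma uniform_first_moment :
  (\int[sigma]_x (`|(x : 'rV[R]_d) ord0 i0|)%:E <= ((Num.sqrt d%:R)^-1)%:E)%E.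
Proof.
set r : R := Num.sqrt d%:R.
have d0 : 0 < d%:R :> R by rewrite ltr0n (leq_trans _ (ltn_ord i0)).
have r0 : 0 < r by rewrite sqrtr_gt0.
have rr : r ^+ 2 = d%:R by rewrite sqr_sqrtr// ltW.
(* The pointwise inequality [|t| <= (r * t ^+ 2 + r^-1) / 2], which is [(r * |t| - 1) ^+ 2 >= 0],
   reduces the first moment to the second. The choice [r = sqrt d] balances the two terms. *)
apply: (@le_trans _ _ (\int[sigma]_x ((r / 2)%:E *
  ((x : 'rV[R]_d) ord0 i0 ^+ 2)%:E + (r^-1 / 2)%:E)))%E.
  apply: ge0_le_integral => //.
  - by apply/measurable_EFinP/measurableT_comp => //; exact: measurable_coord.
  - apply: emeasurable_funD => //; apply/measurable_EFinP/measurable_funM => //.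
    by apply/measurable_funX; exact: measurable_coord.
  - move=> x _; rewrite -EFinM -EFinD lee_fin.
    set t := (x : 'rV[R]_d) ord0 i0.
    have := sqr_ge0 (r * `|t| - 1).
    rewrite -(real_normK (num_real t)) => h.
    rewrite -(@ler_pM2l _ r)// mulrDr (mulrA r r^-1) divff ?gt_eqF//.
    by lra.
rewrite ge0_integralD//; last 3 first.
- by move=> x _; rewrite -EFinM lee_fin mulr_ge0 ?sqr_ge0// divr_ge0// ltW.
- apply/measurable_EFinP/measurable_funM => //.
  by apply/measurable_funX; exact: measurable_coord.
- by move=> x _; rewrite lee_fin divr_ge0// invr_ge0 ltW.
rewrite ge0_integralZl//; last 3 first.
- by apply/measurable_EFinP/measurable_funX; exact: measurable_coord.
- by move=> x _; rewrite lee_fin sqr_ge0.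
- by rewrite lee_fin divr_ge0// ltW.
rewrite integral_cst_probability.
have -> : (\int[sigma]_x ((x : 'rV[R]_d) ord0 i0 ^+ 2)%:E = (d%:R^-1)%:E)%E.
  rewrite -[RHS]mule1 -uniform_second_moment muleA -EFinM.
  by rewrite mulVf ?mul1e// lt0r_neq0.
rewrite -EFinM -EFinD lee_fin -rr le_eqVlt; apply/orP; left; apply/eqP.
by field; exact: lt0r_neq0.
Qed.

End coordinates.
End uniform_sphere.

Section small_ball.
Variables (R : realType) (d : nat) (sigma : probability (borelRV R d) R).
Hypothesis sigmaU : uniform_on_sphere sigma.
Notation basis i := (delta_mx ord0 i : 'rV[R]_d).

Let mcoord (j : 'I_d) :
  measurable_fun setT (fun x : borelRV R d => (x : 'rV[R]_d) ord0 j).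
Proof. exact: measurable_coord. Qed.

Lemma measurable_strip (u : 'rV[R]_d) e :
  measurable [set x : borelRV R d | `|dotrv x u| <= e].
Proof.
have mu : measurable_fun setT (fun x : borelRV R d => `|dotrv x u|).
  by apply: measurableT_comp => //; exact: measurable_dotrvl.
have := mu measurableT `]-oo, e]%classic (measurable_itv _).
by rewrite setTI; congr (measurable _); apply/seteqP; split => x /=;
  rewrite in_itv.
Qed.

Section coordinate_strip.
Variables (i0 : 'I_d) (e : R).
Hypotheses (e0 : 0 < e) (e4 : e <= 4^-1).
Let B := [set x : borelRV R d | `|dotrv x (basis i0)| <= e].
Let c := Num.sqrt (1 - e ^+ 2).

Let mB : measurable B. Proof. exact: measurable_strip. Qed.

Let mind : measurable_fun setT (fun x : borelRV R d => \1_B x : R).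
Proof. exact: measurable_indic. Qed.

Let B_E (x : 'rV[R]_d) : \1_B x = (`|x ord0 i0| <= e)%R%:R :> R.
Proof.
rewrite indicE; congr (nat_of_bool _)%:R; rewrite -(dotrv_delta x i0).
by apply/idP/idP => [|h]; rewrite inE.
Qed.

Let e2 : e ^+ 2 <= 16^-1.
Proof.
have : 0 <= (4^-1 - e) * (4^-1 + e).
  by move: e0 e4 => *; apply: mulr_ge0; lra.
by lra.
Qed.

Let cs : c ^+ 2 + e ^+ 2 = 1.
Proof. by rewrite sqr_sqrtr ?subrK//; move: e2; lra. Qed.

Let c0 : 0 <= c. Proof. exact: sqrtr_ge0. Qed.

(* Rotating by the angle with sine [e] in the plane of the coordinates [i0] and
   [j] preserves the integral of the Huber function of the coordinate [i0]. *)
Let strip_moment (j : 'I_d) : j != i0 ->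
  (\int[sigma]_x (e ^+ 2 * ((x : 'rV[R]_d) ord0 j ^+ 2 * \1_B x))%:E <=
   (e ^+ 2 * (4 * e / Num.sqrt d%:R))%:E)%E.
Proof.
(* The level is [2 * e] because the rotation inequality with sine [e] yields the indicator of
   [|a| <= 2 * e - e], which is the strip [B]. *)
move=> ji; have [e_gt0 c_ge0] := (e0, c0); pose H := huber (2 * e).
have E0 : 0 <= 2 * e by lra.
have mH := measurable_huber (2 * e).
have mHE : measurable_fun setT (fun t => (H t)%:E) by exact/measurable_EFinP.
have H0 t : (0 <= (H t)%:E)%E by rewrite lee_fin huber_ge0.
pose I := (\int[sigma]_x (H (dotrv x (basis i0)))%:E)%E.
have rot t : t ^+ 2 = e ^+ 2 ->
    (\int[sigma]_x (H (dotrv x (c *: basis i0 + t *: basis j)))%:E = I)%E.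
  move=> te; apply: (@uniform_dotrv _ _ _ sigmaU _ _ (fun t => (H t)%:E)) => //.
  rewrite dotrvDl !dotrvDr !dotrvZl !dotrvZr !dotrv_basis !eqxx (negPf ji).
  rewrite eq_sym (negPf ji) !mulr0 !mulr1 addr0 add0r -!expr2 te; exact: cs.
have mHu u : measurable_fun setT (fun x : borelRV R d => (H (dotrv x u))%:E).
  exact: (measurableT_comp mHE (measurable_dotrvl u)).
have mabs : measurable_fun setT (fun x : borelRV R d => `|(x : 'rV[R]_d) ord0 i0|).
  by apply: measurableT_comp => //; exact: mcoord.
have m1 : measurable_fun setT (fun x : borelRV R d =>
    (e ^+ 2 * ((x : 'rV[R]_d) ord0 j ^+ 2 * \1_B x))%:E).
  apply/measurable_EFinP/measurable_funM => //; apply/measurable_funM => //.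
  exact/measurable_funX.
have pos1 (x : borelRV R d) :
    (0 <= (e ^+ 2 * ((x : 'rV[R]_d) ord0 j ^+ 2 * \1_B x))%:E)%E.
  by rewrite lee_fin mulr_ge0 ?sqr_ge0// mulr_ge0 ?sqr_ge0// indicE.
have c1 : c <= 1 by have := cs; nra.
have k0 : 0 <= 2 * (1 - c) * (2 * e) by rewrite !mulr_ge0//; lra.
(* Finiteness is what allows [I + I] to be cancelled from both sides of [main]. *)
have Ifin : I \is a fin_num.
  rewrite ge0_fin_numE; last by apply: integral_ge0 => x _; exact: H0.
  apply: (@le_lt_trans _ _ (\int[sigma]_x (2 * e)%:E)%E); last first.
    by rewrite integral_cst_probability ltry.
  apply: ae_ge0_le_integral => //.
  have FF := ae_filter_ringOfSetsType sigma.
  have u1 : dotrv (basis i0) (basis i0) = 1 by rewrite dotrv_basis eqxx.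
  apply: (@filterS _ _ FF _ _ _ (ae_dotrv_le1 sigmaU u1)) => x x1 _.
  rewrite lee_fin (le_trans (huber_le _ _))//.
  by rewrite -[leRHS]mulr1 ler_wpM2l.
(* This is [huber_rotation] integrated with [a] and [b] the coordinates [i0] and [j]. The two
   rotated terms are projections on unit vectors, so each integrates to [I]. *)
have main : (I + I + \int[sigma]_x
     (e ^+ 2 * ((x : 'rV[R]_d) ord0 j ^+ 2 * \1_B x))%:E <=
   I + I + (2 * (1 - c) * (2 * e))%:E *
     \int[sigma]_x (`|(x : 'rV[R]_d) ord0 i0|)%:E)%E.
  rewrite -[X in (_ <= X + _ + _)%E](rot e)//.
  rewrite -[X in (_ <= _ + X + _)%E](rot (- e)) ?sqrrN//.
  rewrite -ge0_integralZl ?lee_fin//; last first.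
    exact/measurable_EFinP.
  rewrite /I -!ge0_integralD//.
  - have FF := ae_filter_ringOfSetsType sigma.
    apply: ae_ge0_le_integral => //.
    + by move=> x _; rewrite !adde_ge0.
    + by do !apply: emeasurable_funD.
    + by move=> x _; rewrite !adde_ge0// -EFinM lee_fin mulr_ge0.
    + do !apply: emeasurable_funD => //.
      by apply/measurable_EFinP/measurable_funM.
    have u1 : dotrv (basis j) (basis j) = 1 by rewrite dotrv_basis eqxx.
    apply: (@filterS _ _ FF _ _ _ (ae_dotrv_le1 sigmaU u1)) => x x1 _.
    rewrite -EFinM -!EFinD lee_fin B_E !dotrvDr !dotrvZr !dotrv_delta mulNr.
    rewrite dotrv_delta in x1.
    have := @huber_rotation R _ E0 c e (x ord0 i0) (x ord0 j) c0 cs (ltW e0) x1.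
    have -> : 2 * e - e = e by ring.
    by rewrite -/H; set a := H _; set b := (_ <= _)%R%:R; lra.
  - by move=> x _; rewrite adde_ge0.
  - by apply: emeasurable_funD.
  - by move=> x _; rewrite -EFinM lee_fin mulr_ge0.
  - by apply/measurable_EFinP/measurable_funM.
  - by move=> x _; rewrite adde_ge0.
  - by apply: emeasurable_funD.
rewrite leeD2lE in main; last by rewrite fin_numD Ifin.
apply: (le_trans main).
apply: (@le_trans _ _ ((2 * (1 - c) * (2 * e))%:E * ((Num.sqrt d%:R)^-1)%:E)%E).
  by apply: lee_wpmul2l; rewrite ?lee_fin//; exact: uniform_first_moment.
rewrite -EFinM lee_fin mulrA ler_wpM2r ?invr_ge0 ?sqrtr_ge0//.
(* Since [1 - c <= (1 - c) * (1 + c) = e ^+ 2], the error is of second order in the angle, like the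
   gain. *)
have := cs; have : (1 - c) * 1 <= (1 - c) * (1 + c).
  by apply: ler_wpM2l; lra.
rewrite mulrCA -!mulrA => h1 h2.
have : 4 * e * (1 - c) <= 4 * e * e ^+ 2 by apply: ler_wpM2l; lra.
by lra.
Qed.

Lemma coordinate_strip_le :
  (sigma [set x : borelRV R d | (`|dotrv x (basis i0)| <= e)%R] <=
   (6 * Num.sqrt d%:R * e)%:E)%E.
Proof.
rewrite -/B; have [e_gt0 sqr_e] := (e0, e2).
have d0 : 0 < d%:R :> R by rewrite ltr0n (leq_trans _ (ltn_ord i0)).
have r0 : 0 < Num.sqrt d%:R :> R by rewrite sqrtr_gt0.
have m1 j : measurable_fun setT (fun x : borelRV R d =>
    (e ^+ 2 * ((x : 'rV[R]_d) ord0 j ^+ 2 * \1_B x))%:E).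
  apply/measurable_EFinP/measurable_funM => //; apply/measurable_funM => //.
  exact/measurable_funX.
have pos1 j (x : borelRV R d) :
    (0 <= (e ^+ 2 * ((x : 'rV[R]_d) ord0 j ^+ 2 * \1_B x))%:E)%E.
  by rewrite lee_fin mulr_ge0 ?sqr_ge0// mulr_ge0 ?sqr_ge0// indicE.
have h : ((e ^+ 2 * (1 - e ^+ 2))%:E * sigma B <=
    (e ^+ 2 * (4 * Num.sqrt d%:R * e))%:E)%E.
  (* There are at most [d] terms, each bounded by [strip_moment], so they total at most
     [e ^+ 2 * (4 * sqrt d * e)]. On the strip the squares of the other coordinates sum to at least
     [1 - e ^+ 2]. *)
  apply: (@le_trans _ _ (\sum_(j < d | j != i0) \int[sigma]_x
      (e ^+ 2 * ((x : 'rV[R]_d) ord0 j ^+ 2 * \1_B x))%:E)%E); last first.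
    apply: (@le_trans _ _ (\sum_(j < d | j != i0)
        (e ^+ 2 * (4 * e / Num.sqrt d%:R))%:E)%E).
      by apply: lee_sum => j; exact: strip_moment.
    rewrite sumEFin lee_fin sumr_const -(mulr_natl (e ^+ 2 * (4 * e / Num.sqrt d%:R))).
    rewrite mulrCA ler_wpM2l ?sqr_ge0//.
    have -> : 4 * Num.sqrt d%:R * e = d%:R * (4 * e / Num.sqrt d%:R) :> R.
      rewrite -{2}(sqr_sqrtr (ltW d0)); field; exact: lt0r_neq0.
    apply: ler_wpM2r; first by rewrite divr_ge0//; lra.
    by rewrite ler_nat (leq_trans (max_card _))// card_ord.
  rewrite -big_filter -ge0_integral_sum//.
  rewrite -[X in sigma X](setIT B) -(integral_indic sigma measurableT mB).
  rewrite -ge0_integralZl//; last 2 first.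
  - exact/measurable_EFinP.
  - by rewrite lee_fin mulr_ge0 ?sqr_ge0//; lra.
  have FF := ae_filter_ringOfSetsType sigma.
  apply: ae_ge0_le_integral => //.
  - move=> x _; rewrite -EFinM lee_fin mulr_ge0// mulr_ge0 ?sqr_ge0//; lra.
  - by apply/measurable_EFinP/measurable_funM.
  - by move=> x _; apply: sume_ge0 => *; exact: pos1.
  - exact: emeasurable_sum.
  apply: (@filterS _ _ FF _ _ _ (ae_sphere sigmaU)) => x x1 _.
  rewrite big_filter sumEFin -EFinM lee_fin -mulr_sumr -mulrA ler_wpM2l ?sqr_ge0//.
  rewrite -mulr_suml.
  have [xe|/negPf xe] := boolP (`|x ord0 i0| <= e); last first.
    by rewrite B_E xe !mulr0.
  apply: ler_wpM2r => //.
  have : x ord0 i0 ^+ 2 <= e ^+ 2.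
    by rewrite -(real_normK (num_real (x ord0 i0))) ler_pXn2r// nnegrE// ltW.
  have <- : \sum_(j < d) x ord0 j ^+ 2 = 1.
    by rewrite -x1; apply: eq_bigr => j _; rewrite expr2.
  by rewrite (bigD1 i0)//=; lra.
have Bfin : sigma B \is a fin_num by exact: fin_num_measure.
move: h; rewrite -(fineK Bfin) -EFinM !lee_fin => h.
have s0 : 0 <= fine (sigma B) by exact: fine_ge0.
move: h; rewrite -(mulrA (e ^+ 2)) ler_pM2l ?exprn_gt0// => h.
(* The assumption [e <= 1/4] gives [1 - e ^+ 2 >= 15/16], and [4 * 16 / 15] is below the announced
   constant [6]. *)
have q : 15 / 16 * fine (sigma B) <= (1 - e ^+ 2) * fine (sigma B).
  by apply: ler_wpM2r => //; lra.
have : 0 <= Num.sqrt d%:R * e by rewrite mulr_ge0// ltW.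
by lra.
Qed.

End coordinate_strip.

Lemma uniform_strip_le (z : 'rV[R]_d) (e : R) : z != 0 -> 0 < e ->
  (sigma [set x : borelRV R d | (`|dotrv x z| <= e)%R] <=
   (6 * Num.sqrt d%:R * e / enorm z)%:E)%E.
Proof.
move=> z0 e0.
have [i0 _] : exists i0 : 'I_d, z ord0 i0 != 0.
  apply/existsP; apply: contraNT z0; rewrite negb_exists => /forallP h.
  by apply/eqP/rowP => i; rewrite mxE; apply/eqP; rewrite -[_ == _]negbK h.
have n0 : 0 < enorm z by rewrite lt_def enorm_eq0 z0 enorm_ge0.
pose u := (enorm z)^-1 *: z.
have u1 : dotrv u u = 1.
  by rewrite dotrvZl dotrvZr -sqr_enorm; field; exact: lt0r_neq0.
have zu x : (`|dotrv x z| <= e) = (`|dotrv x u| <= e / enorm z).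
  by rewrite dotrvZr normrM gtr0_norm ?invr_gt0// mulrC ler_pM2r ?invr_gt0.
pose F (t : R) : \bar R := (\1_[set t : R | (`|t| <= e / enorm z)%R] t)%:E.
have mset : measurable [set t : R | (`|t| <= e / enorm z)%R].
  rewrite (_ : [set _ | _] = `[- (e / enorm z), (e / enorm z)]%classic).
    exact: measurable_itv.
  by apply/seteqP; split => t /=; rewrite in_itv/= ler_norml.
have E v : (sigma [set x : borelRV R d | (`|dotrv x v| <= e / enorm z)%R] =
    \int[sigma]_x F (dotrv x v))%E.
  rewrite -[in LHS](setIT [set _ | _]) -integral_indic//.
  exact: measurable_strip.
rewrite (_ : [set _ | _] = [set x : borelRV R d | `|dotrv x u| <= e / enorm z]); last first.
  by apply/seteqP; split => x /=; rewrite zu.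
have eu : dotrv u u = dotrv (basis i0) (basis i0).
  by rewrite u1 dotrv_basis eqxx.
rewrite E (uniform_dotrv sigmaU eu); last 2 first.
- exact/measurable_EFinP/measurable_indic.
- by move=> t; rewrite lee_fin.
rewrite -E -mulrA; set f := e / enorm z.
have f0 : 0 < f by rewrite divr_gt0.
(* For a wider strip the bound exceeds [6 / 4 > 1] and holds for any probability. *)
have [f4|f4] := leP f 4^-1; first exact: coordinate_strip_le.
apply: (le_trans (probability_le1 _ (measurable_strip _ _))).
have d1 : 1 <= Num.sqrt d%:R :> R.
  by rewrite -[leLHS]sqrtr1 ler_sqrt// ler1n (leq_trans _ (ltn_ord i0)).
by rewrite lee_fin; nra.
Qed.

End small_ball.

(** * Countable unions and supports *)

Section countable_union.
Context dT (T : measurableType dT) (I : choiceType) (Y : set I) (F : I -> set T).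

(** With [f] injective on [Y], the set indexed by [n] on the right is either a single [F y] or
    empty. A union over a countable [Y] thus becomes a union of a sequence. *)
Lemma bigcup_countableE (f : I -> nat) :
  \bigcup_(y in Y) F y = \bigcup_n \bigcup_(y in Y `&` f @^-1` [set n]) F y.
Proof.
apply/seteqP; split => [t [y Yy Fy]|t [n _ [y [Yy _] Fy]]].
  by exists (f y) => //; exists y.
by exists y.
Qed.

Lemma bigcup_fiber (f : I -> nat) (y : I) : {in Y &, injective f} -> Y y ->
  \bigcup_(z in Y `&` f @^-1` [set f y]) F z = F y.
Proof.
move=> inj Yy; apply/seteqP; split => [t [z [Yz /= fz]]|t Fy].
  by rewrite (inj z y) ?inE.
by exists y.
Qed.

Lemma bigcup_fiber0 (f : I -> nat) n : ~ (f @` Y) n ->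
  \bigcup_(z in Y `&` f @^-1` [set n]) F z = set0.
Proof.
move=> nY; rewrite -subset0 => t [z [Yz /= fz]] _.
by apply: nY; exists z.
Qed.

Lemma countable_bigcup_measurable : countable Y ->
  (forall y, Y y -> measurable (F y)) -> measurable (\bigcup_(y in Y) F y).
Proof.
move=> /countable_injP[f inj] mF; rewrite (bigcup_countableE f).
apply: bigcupT_measurable => n.
have [[y Yy <-]|nY] := pselect ((f @` Y) n); last by rewrite bigcup_fiber0.
by rewrite bigcup_fiber//; exact: mF.
Qed.

Lemma measure_bigcup_le_esum (R : realType) (mu : {measure set T -> \bar R}) :
  countable Y -> (forall y, Y y -> measurable (F y)) ->
  (mu (\bigcup_(y in Y) F y) <= \esum_(y in Y) mu (F y))%E.
Proof.
move=> cY mF; have mU := countable_bigcup_measurable cY mF.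
have /countable_injP[f inj] := cY.
pose G n := \bigcup_(y in Y `&` f @^-1` [set n]) F y.
have mG n : measurable (G n).
  rewrite /G; have [[y Yy <-]|nY] := pselect ((f @` Y) n); last by rewrite bigcup_fiber0.
  by rewrite bigcup_fiber//; exact: mF.
apply: (@le_trans _ _ (\sum_(0 <= n <oo) mu (G n))%E).
  by apply: measure_sigma_subadditive => //; rewrite (bigcup_countableE f).
rewrite nneseries_esumT// le_eqVlt; apply/orP; left; apply/eqP.
have -> : (\esum_(y in Y) mu (F y) = \esum_(y in Y) mu (G (f y)))%E.
  by apply: eq_esum => y Yy; rewrite /G bigcup_fiber.
rewrite -(esum_image Y f (fun n => mu (G n)))//.
rewrite [RHS]esum_mkcond; apply: eq_esum => n _.
case: ifPn => // /negP; rewrite inE => nY.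
by rewrite /G bigcup_fiber0.
Qed.

End countable_union.

(** The infimum is below [r] exactly when some [h t y] is. Nonemptiness and the lower bound [0] make
    the real-valued [inf] a true infimum. *)
Lemma measurable_inf_countable dT (T : measurableType dT) (R : realType)
    (I : choiceType) (Y : set I) (h : T -> I -> R) :
  countable Y -> Y !=set0 -> (forall y, measurable_fun setT (h ^~ y)) ->
  (forall t y, 0 <= h t y) ->
  measurable_fun setT (fun t => inf [set h t y | y in Y]).
Proof.
move=> cY [y0 Yy0] mh h0.
apply: (measurability _ (RGenInftyO.measurableE R)) => // _ [_ [r ->] <-].
rewrite setTI.
have -> : (fun t => inf [set h t y | y in Y]) @^-1` `]-oo, r[ =
    \bigcup_(y in Y) (h ^~ y @^-1` `]-oo, r[).
  apply/seteqP; split => t /=.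
    rewrite in_itv/= => /inf_lt[|_ [y Yy <-] hr]; first by exists (h t y0), y0.
    by exists y => //=; rewrite in_itv.
  move=> [y Yy /=]; rewrite !in_itv/=; apply: le_lt_trans.
  apply: ge_inf; last by exists y.
  by exists 0 => _ [z _ <-].
apply: countable_bigcup_measurable => // y _.
by rewrite -[X in measurable X]setTI; apply: mh.
Qed.

(* [ge0_le_integral] does not apply to the sliced transport cost, which is not
   known to be measurable in the direction. *)
Lemma le_nnintegral dT (T : measurableType dT) (R : realType)
    (mu : {measure set T -> \bar R}) (D : set T) (f g : T -> \bar R) :
  (forall x, D x -> 0 <= f x)%E -> (forall x, D x -> f x <= g x)%E ->
  (\int[mu]_(x in D) f x <= \int[mu]_(x in D) g x)%E.
Proof.
move=> f0 fg; rewrite !ge0_integralE//; last first.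
  by move=> x Dx; apply: le_trans (fg x Dx); exact: f0.
(* Each simple function below [f] is below [g], so the supremum defining the integral can only grow;
   measurability does not enter. *)
apply: le_ereal_sup => _ [h hf <-]; exists h => // x; apply: (le_trans (hf x)).
by rewrite !patchE; case: ifP => // /set_mem; exact: fg.
Qed.

Section support.
Variables (R : realType) (d : nat) (nu : probability (borelRV R d) R).

Lemma measurable_set1_rV (y : 'rV[R]_d) : measurable ([set y] : set (borelRV R d)).
Proof.
have m : measurable_fun setT (fun x : borelRV R d => enorm ((x : 'rV[R]_d) - y)).
  by apply: measurable_fun_enorm; exact: measurable_fun_subrv.
have := m measurableT [set 0] (measurable_set1 _).
rewrite setTI; congr (measurable _); apply/seteqP; split => x /= => [/eqP|->].
  by rewrite enorm_eq0 subr_eq0 => /eqP.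
by apply/eqP; rewrite enorm_eq0 subrr.
Qed.

Lemma measurable_countable_rV (Y : set 'rV[R]_d) : countable Y ->
  measurable (Y : set (borelRV R d)).
Proof.
exact: (@countable_measurable _ (borelRV R d) Y measurable_set1_rV).
Qed.

(** Each point outside the support has a null neighbourhood, hence lies in a null rational box, and
    there are countably many such boxes. *)
Lemma msupport_setC0 : nu.-negligible (~` (msupport nu : set (borelRV R d))).
Proof.
pose P := [set qk | nu (rat_box qk) = 0%E].
apply: (@negligibleS _ _ _ nu (\bigcup_(qk in P) rat_box qk)).
  move=> x /= /existsNP[U] /not_implyP[oU /not_implyP[Ux]].
  move/negP; rewrite -leNgt => nuU.
  have [qk xqk qkU] := rat_box_nbhs (open_nbhs_nbhs (conj oU Ux)).
  exists qk => //; apply/eqP; rewrite eq_le measure_ge0 andbT.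
  apply: le_trans nuU; apply: le_measure => //; rewrite inE.
    exact: measurable_rat_box.
  exact: sub_sigma_algebra.
exists (\bigcup_(qk in P) rat_box qk); split => //.
  by apply: (countable_bigcup_measurable (countableP P)) => qk _; exact: measurable_rat_box.
apply/eqP; rewrite eq_le measure_ge0 andbT.
apply: (le_trans (measure_bigcup_le_esum nu (countableP P)
  (fun qk _ => @measurable_rat_box R d qk))).
by rewrite esum1.
Qed.

End support.

(** * Lower bounds for transport costs *)

Lemma esumZl_le (R : realType) (I : choiceType) (Y : set I) (c : R)
    (a : I -> \bar R) : 0 <= c -> (forall y, 0 <= a y)%E ->
  (\esum_(y in Y) (c%:E * a y) <= c%:E * \esum_(y in Y) a y)%E.
Proof.
move=> c0 a0; apply: ge_ereal_sup => _ [X [finX XY] <-].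
rewrite -ge0_mule_fsumr//; apply: lee_wpmul2l; first by rewrite lee_fin.
by apply: esum_ge; exists X.
Qed.

Section dist_set.
Variables (R : realType) (d : nat).
Implicit Types (x y : 'rV[R]_d) (Y : set 'rV[R]_d).

Lemma dist_set_le x y Y : Y y -> dist_set x Y <= enorm (x - y).
Proof.
move=> Yy; apply: ge_inf; last by exists y.
by exists 0 => _ [z _ <-]; exact: enorm_ge0.
Qed.

Lemma dist_set_ge0 x Y : 0 <= dist_set x Y.
Proof.
have [->|Y0] := eqVneq Y set0.
  by rewrite /dist_set image_set0 inf0.
apply: lb_le_inf; last by move=> _ [y _ <-]; exact: enorm_ge0.
by case/set0P: Y0 => y Yy; exists (enorm (x - y)), y.
Qed.

Lemma dist_set_mem x Y : Y x -> dist_set x Y = 0.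
Proof.
move=> Yx; apply/eqP; rewrite eq_le dist_set_ge0 andbT.
by rewrite (le_trans (dist_set_le _ Yx))// subrr le_eqVlt enorm_eq0 eqxx.
Qed.

Lemma measurable_dist_set Y : countable Y -> Y !=set0 ->
  measurable_fun setT (fun x : borelRV R d => dist_set x Y).
Proof.
move=> cY Y0.
apply: (@measurable_inf_countable _ (borelRV R d) R _ Y
  (fun x y => enorm ((x : 'rV[R]_d) - y))) => // [y|x y]; last exact: enorm_ge0.
by apply: measurable_fun_enorm; exact: measurable_fun_subrv.
Qed.

End dist_set.

Section wasserstein.
Context (R : realType) dT (T : measurableType dT) (dist : T -> T -> R) (p : R).
Hypothesis p1 : 1 <= p.
Variables mu nu : set T -> \bar R.

Let p0 : 0 < p. Proof. exact: lt_le_trans p1. Qed.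

Let inf_ge0 : (0 <= ereal_inf [set \int[gamma]_z ((dist z.1 z.2) `^ p)%:E
  | gamma in [set gamma : probability (T * T)%type R | coupling mu nu gamma]])%E.
Proof.
apply: le_ereal_inf_tmp => _ [gamma _ <-]; apply: integral_ge0 => z _.
by rewrite lee_fin powR_ge0.
Qed.

Lemma Wasserstein_le (gamma : probability (T * T)%type R) :
  coupling mu nu gamma ->
  (Wasserstein dist p mu nu <=
   (\int[gamma]_z ((dist z.1 z.2) `^ p)%:E) `^ p^-1)%E.
Proof.
move=> g; apply: gt0_ler_poweR.
- by rewrite invr_ge0 ltW.
- by rewrite in_itv/= inf_ge0 leey.
- rewrite in_itv/= leey andbT; apply: integral_ge0 => z _.
  by rewrite lee_fin powR_ge0.
- by apply: ereal_inf_lbound; exists gamma.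
Qed.

Lemma Wasserstein_powR_ge (a : \bar R) :
  (forall gamma : probability (T * T)%type R, coupling mu nu gamma ->
    a <= \int[gamma]_z ((dist z.1 z.2) `^ p)%:E)%E ->
  (a <= Wasserstein dist p mu nu `^ p)%E.
Proof.
move=> ag; rewrite /Wasserstein -poweRrM mulVf ?lt0r_neq0// poweRe1//.
by apply: le_ereal_inf_tmp => _ [gamma g <-]; exact: ag.
Qed.

End wasserstein.

Section support_facts.
Variables (R : realType) (d : nat) (nu : probability (borelRV R d) R).
Notation Y := (msupport nu).
Hypothesis cY : countable Y.

Lemma msupport_disjoint0 (B : set (borelRV R d)) : measurable B ->
  B `&` Y = set0 -> nu B = 0%E.
Proof.
move=> mB BY; apply: measure_negligible => //.
by apply: negligibleS (msupport_setC0 nu); rewrite -disjoints_subset.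
Qed.

Lemma msupport_neq0 : Y !=set0.
Proof.
apply/set0P/negP => /eqP Y0.
have : nu setT = 0%E by apply: msupport_disjoint0 => //; rewrite Y0 setI0.
by rewrite [X in X = _](@probability_setT _ _ _ nu) => /eqP; rewrite onee_eq0.
Qed.

End support_facts.

Section slices.
Variables (R : realType) (d : nat) (p : R) (mu nu : probability (borelRV R d) R).
Hypothesis p1 : 1 <= p.
Notation Y := (msupport nu).
Hypothesis cY : countable Y.

(** The projection of the support need not be closed, so this infimum may fail to be attained. *)
Definition slice_dist (theta : 'rV[R]_d) (s : R) : R :=
  inf [set `|s - dotrv theta y| | y in Y].

Lemma slice_dist_le theta s y : Y y -> slice_dist theta s <= `|s - dotrv theta y|.
Proof.
by move=> Yy; apply: ge_inf; [exists 0 => _ [z _ <-]|exists y].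
Qed.

Lemma slice_dist_ge theta s a : (forall y, Y y -> a <= `|s - dotrv theta y|) ->
  a <= slice_dist theta s.
Proof.
move=> h; apply: lb_le_inf; last by move=> _ [y Yy <-]; exact: h.
by have [y Yy] := msupport_neq0 nu; exists `|s - dotrv theta y|, y.
Qed.

Lemma measurable_slice_dist theta : measurable_fun setT (slice_dist theta).
Proof.
apply: (@measurable_inf_countable _ R R _ Y (fun s y => `|s - dotrv theta y|)) => //.
- exact: msupport_neq0.
- by move=> y; apply: measurableT_comp => //; exact: measurable_funB.
Qed.

(** Under any coupling of the projections, the second coordinate almost surely lies in the
    projection of [Y]. The cost therefore dominates the distance from the first coordinate to that
    projection, and the first coordinate has the law of [dotrv theta x] under [mu]. *)
Lemma Wp1_slice_ge (theta : 'rV[R]_d) :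
  (\int[mu]_x ((slice_dist theta (dotrv theta x)) `^ p)%:E <=
   Wp1 p (slice_pushforward theta mu) (slice_pushforward theta nu) `^ p)%E.
Proof.
have mdot : measurable_fun setT (fun x : borelRV R d => dotrv theta x).
  exact: (measurable_fun_dotrv (@measurable_cst _ _ _ (borelRV R d) setT theta)).
have mpow : measurable_fun setT (fun s => ((slice_dist theta s) `^ p)%:E).
  apply/measurable_EFinP; apply: (measurableT_comp (measurable_powR p)).
  exact: measurable_slice_dist.
apply: Wasserstein_powR_ge => // gamma g.
rewrite (@ge0_integral_image _ _ _ _ _ _ _ _ _ mu gamma
  (fun s => ((slice_dist theta s) `^ p)%:E) mdot measurable_fst)//; last 2 first.
- by move=> A mA; rewrite [RHS](g A mA).1.
- by move=> s; rewrite lee_fin powR_ge0.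
(* Countability of [Y] makes its projection Borel, so the marginal condition applies to the
   complement. *)
pose Z : set (measurableTypeR R) := dotrv theta @` Y.
have mZ : measurable Z.
  apply: countable_measurable; first exact: measurable_set1.
  exact: (sub_countable (card_image_le _ _) cY).
apply: ae_ge0_le_integral => //.
- by move=> z _; rewrite lee_fin powR_ge0.
- exact: (measurableT_comp mpow (@measurable_fst _ _ (measurableTypeR R) (measurableTypeR R))).
- apply/measurable_EFinP; apply: (measurableT_comp (measurable_powR p)).
  by apply: measurableT_comp => //; apply: measurable_funB.
exists (snd @^-1` ~` Z); split.
- by rewrite -[X in measurable X]setTI; apply: measurable_snd => //; exact: measurableC.
- rewrite -[LHS]/(pushforward gamma snd (~` Z)) (g _ (measurableC mZ)).2.
  apply: msupport_disjoint0 => //.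
    by rewrite -[X in measurable X]setTI; apply: mdot => //; exact: measurableC.
  by rewrite -subset0 => x [/= nZ Yx]; apply: nZ; exists x.
move=> z /= h [y Yy yz]; apply: h => _.
have p0 : 0 <= p by exact: le_trans p1.
rewrite lee_fin ge0_ler_powR ?nnegrE//.
  by apply: slice_dist_ge => y' _; exact: normr_ge0.
by rewrite -yz; exact: slice_dist_le.
Qed.

End slices.

(** * Sliced cost versus distance to the support *)

Section comparison.
Variables (R : realType) (d : nat) (mu nu : probability (borelRV R d) R).
Notation Y := (msupport nu).
Hypothesis cY : countable Y.

Let delta (x : 'rV[R]_d) := dist_set x Y.

Let mdelta : measurable_fun setT (fun x : borelRV R d => delta x).
Proof. by apply: measurable_dist_set => //; exact: msupport_neq0. Qed.

Let inv_dist_ge0 (x y : 'rV[R]_d) : (0 <= ((enorm (x - y))^-1)%:E :> \bar R)%E.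
Proof. by rewrite lee_fin invr_ge0 enorm_ge0. Qed.

Let invsum (x : 'rV[R]_d) : \bar R :=
  (\esum_(y in Y) ((enorm (x - y))^-1)%:E)%E.

(** This replaces the essential supremum by an almost-sure bound with a real [k]. If [mu] is
    concentrated on [Y], then [delta] vanishes almost everywhere and the condition is void. *)
Lemma Kparam_ae : (Kparam mu nu < +oo)%E -> exists k : R,
  [/\ Kparam mu nu = k%:E, 0 <= k &
  {ae mu, forall x, 0 < delta x -> 0 < k /\
    ((delta x)%:E * invsum x <= k%:E)%E}].
Proof.
have FF := ae_filter_ringOfSetsType mu.
have mY := measurable_countable_rV cY.
rewrite /Kparam; case: eqP => [muY1 _|muY1].
  exists 1; split => //; exists (~` (Y : set (borelRV R d))); split.
  - exact: measurableC.
  - by rewrite probability_setC// [X in (1 - X)%E]muY1 subee.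
  - by move=> x /=; apply: contra_not => Yx; rewrite /delta dist_set_mem// ltxx.
set f := (X in ess_sup mu X); set K := ess_sup mu f => Koo.
have fK : {ae mu, forall x, (f x <= K)%E} by exact: ess_sup_ge.
have fE x : ~ Y x -> f x =
    ((delta x)%:E * invsum x)%E.
  by move=> nY; rewrite /f ifF//; apply/negP; rewrite inE.
have K0 : (0 <= K)%E.
  (* The integrand is nonnegative off [Y], so a negative essential supremum would force [mu] to be
     concentrated on [Y]. *)
  rewrite leNgt; apply/negP => K0; apply: muY1.
  have [N [mN N0 NK]] := fK.
  suff C0 : mu (~` (Y : set (borelRV R d))) = 0%E.
    by rewrite -(setCK Y) probability_setC ?C0 ?sube0//; exact: measurableC.
  apply: (subset_measure0 _ mN _ N0); first exact: measurableC.
  move=> x /= nY; apply: NK => /= fxK; have := le_lt_trans fxK K0.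
  rewrite fE// ltNge mule_ge0//; first by rewrite lee_fin dist_set_ge0.
  by apply: esum_ge0 => y _.
have Kfin : K \is a fin_num by rewrite ge0_fin_numE.
exists (fine K); rewrite fineK//; split => //; first exact: fine_ge0.
apply: (@filterS _ _ FF _ _ _ fK) => x fxK dx.
have nYx : ~ Y x by move=> Yx; move: dx; rewrite /delta dist_set_mem// ltxx.
rewrite -fE//; split => //; rewrite -lte_fin fineK//; apply: lt_le_trans fxK.
rewrite fE// mule_gt0 ?lte_fin//.
(* A single term of the sum is already positive, which gives [0 < k]. *)
have [y Yy] := msupport_neq0 nu.
have xy : 0 < (enorm ((x : 'rV[R]_d) - y))^-1.
  by rewrite invr_gt0 (lt_le_trans dx)// dist_set_le.
apply: (@lt_le_trans _ _ ((enorm ((x : 'rV[R]_d) - y))^-1)%:E); first by rewrite lte_fin.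
apply: esum_ge; exists [set y]; last by rewrite fsbig_set1.
by split; [exact: finite_set1|move=> _ ->].
Qed.

Variables (sigma : probability (borelRV R d) R).
Hypothesis sigmaU : uniform_on_sphere sigma.
Variables (k : R).
Hypothesis k0 : 0 < k.
(** Chosen so that [6 * sqrt d * t * k = 1/2], the total measure allowed to the excluded strips. *)
Let t := (12 * Num.sqrt d%:R * k)^-1.

(** Pairs of a direction and a point whose projection keeps distance more than [t * delta] from
    every projected atom. It is a subset of the product so that Tonelli applies, and the complement
    of a countable union so that the union bound does. *)
Definition separated : set (borelRV R d * borelRV R d) :=
  ~` \bigcup_(y in Y) [set z | `|dotrv z.1 ((z.2 : 'rV[R]_d) - y)| <= t * delta z.2].

Lemma measurable_separated : measurable separated.
Proof.
apply: measurableC; apply: countable_bigcup_measurable => // y _.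
rewrite -[X in measurable X]setTI; apply: measurable_fun_le => //.
- have my : measurable_fun setT (fun z : borelRV R d * borelRV R d =>
      (z.2 : 'rV[R]_d) - y : borelRV R d).
    by apply: measurable_fun_subrv; [exact: measurable_snd|exact: measurable_cst].
  by apply: measurableT_comp => //; exact: (measurable_fun_dotrv measurable_fst my).
- apply: measurable_funM => //.
  exact: (measurableT_comp mdelta measurable_snd).
Qed.

Lemma separated_section_ge (x : 'rV[R]_d) : 0 < Num.sqrt d%:R :> R ->
  0 < delta x ->
  ((delta x)%:E * invsum x <= k%:E)%E ->
  ((2^-1)%:E <= sigma [set theta | separated (theta, x)])%E.
Proof.
move=> sd0 dx xk.
have t0 : 0 < t by rewrite invr_gt0 !mulr_gt0.
have -> : [set theta | separated (theta, x)] = ~` \bigcup_(y in Y)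
    [set theta : borelRV R d | `|dotrv theta (x - y)| <= t * delta x].
  by [].
have mU : measurable (\bigcup_(y in Y)
    [set theta : borelRV R d | `|dotrv theta (x - y)| <= t * delta x]).
  by apply: countable_bigcup_measurable => // y _; exact: measurable_strip.
rewrite probability_setC// leeBrDr ?fin_num_measure//.
have -> : 1%E = ((2^-1)%:E + (2^-1)%:E)%E :> \bar R by rewrite -EFinD; congr _%:E; lra.
rewrite leeD2lE//.
apply: (le_trans (measure_bigcup_le_esum sigma cY _)).
  by move=> y _; exact: measurable_strip.
(* Each strip has half-width [t * delta x] and normal [x - y], which is nonzero because [delta x] is
   positive. *)
apply: (@le_trans _ _ (\esum_(y in Y) ((6 * Num.sqrt d%:R * t * delta x)%:E *
    ((enorm (x - y))^-1)%:E))%E).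
  apply: le_esum => y Yy; rewrite -EFinM -(mulrA _ t).
  apply: uniform_strip_le => //; last by rewrite mulr_gt0.
  by rewrite -enorm_eq0 gt_eqF// (lt_le_trans dx)// dist_set_le.
apply: (le_trans (esumZl_le _ _ _)) => //.
  by rewrite !mulr_ge0// ltW.
rewrite EFinM -muleA.
apply: (@le_trans _ _ ((6 * Num.sqrt d%:R * t)%:E * k%:E)%E).
  by apply: lee_wpmul2l => //; rewrite lee_fin !mulr_ge0// ltW.
rewrite -EFinM lee_fin /t le_eqVlt; apply/orP; left; apply/eqP.
by field; rewrite !lt0r_neq0.
Qed.

Variable p : R.
Hypothesis p1 : 1 <= p.

Let p0 : 0 < p. Proof. exact: lt_le_trans p1. Qed.

Lemma sliced_integral_ge : 0 < Num.sqrt d%:R :> R ->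
  {ae mu, forall x, 0 < delta x ->
    ((delta x)%:E * invsum x <= k%:E)%E} ->
  ((2^-1 * t `^ p)%:E * \int[mu]_x ((delta x) `^ p)%:E <=
   \int[sigma]_(theta in sphere R d)
     (Wp1 p (slice_pushforward theta mu) (slice_pushforward theta nu)) `^ p)%E.
Proof.
move=> sd0 xk.
have FF := ae_filter_ringOfSetsType mu.
have t0 : 0 < t by rewrite invr_gt0 !mulr_gt0.
(* A jointly measurable minorant of the [p]-th power of the slice distance. It is integrated first
   in the point, to compare with the sliced cost, and then in the direction. *)
pose F (z : borelRV R d * borelRV R d) : \bar R :=
  (((t * delta z.2) `^ p)%:E * (\1_separated z)%:E)%E.
have F0 z : (0 <= F z)%E by rewrite mule_ge0// lee_fin powR_ge0.
have mpow (q : R) : measurable_fun setT (fun x : borelRV R d => ((q * delta x) `^ p)%:E).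
  apply/measurable_EFinP; apply: (measurableT_comp (measurable_powR p)).
  exact: measurable_funM.
have mF : measurable_fun setT F.
  apply: emeasurable_funM.
    exact: (measurableT_comp (mpow t) measurable_snd).
  by apply/measurable_EFinP; apply: measurable_indic; exact: measurable_separated.
have mpair (x : borelRV R d) :
    measurable_fun setT (fun theta : borelRV R d => (theta, x)).
  exact: measurable_fun_pair.
have Fsep theta x : (F (theta, x) <= ((slice_dist nu theta (dotrv theta x)) `^ p)%:E)%E.
  rewrite /F /= indicE; have [/set_mem sep|_] /= := boolP (_ \in _).
    rewrite mule1 lee_fin ge0_ler_powR ?nnegrE//; first exact: ltW.
    - by rewrite mulr_ge0 ?dist_set_ge0// ltW.
    - by apply: slice_dist_ge => y _.
    - apply: slice_dist_ge => y Yy; rewrite -dotrvBr leNgt; apply/negP => h.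
      by apply: sep; exists y => //=; exact: ltW.
  by rewrite mule0 lee_fin powR_ge0.
have mF1 : measurable_fun setT (fun theta => \int[mu]_x F (theta, x))%E.
  exact: measurable_fun_fubini_tonelli_F.
have F10 theta : (0 <= \int[mu]_x F (theta, x))%E by apply: integral_ge0.
apply: (@le_trans _ _ (\int[sigma]_(theta in sphere R d) \int[mu]_x F (theta, x))%E); last first.
  apply: le_nnintegral => [theta _|theta _]; first exact: F10.
  apply: le_trans (Wp1_slice_ge mu p1 cY theta).
  apply: le_nnintegral => [x _|x _]; [exact: F0|exact: Fsep].
have -> : (\int[sigma]_(theta in sphere R d) \int[mu]_x F (theta, x) =
    \int[sigma]_theta \int[mu]_x F (theta, x))%E.
  have mS := @measurable_sphere R d.
  have S0 : sigma (~` (sphere R d : set (borelRV R d))) = 0%E.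
    by rewrite probability_setC; [rewrite sigmaU.1 subee|exact: mS].
  rewrite [RHS](@lebesgue_integral_nonneg.ge0_negligible_integral _ _ _ sigma setT
    (~` (sphere R d : set (borelRV R d))))//.
  - by rewrite setTD setCK.
  - exact: measurableC.
  - by move=> theta _; exact: F10.
rewrite (fubini_tonelli F)//.
rewrite -ge0_integralZl//; last 3 first.
- by have := mpow 1; under eq_fun do rewrite mul1r.
- by move=> x _; rewrite lee_fin powR_ge0.
- by rewrite lee_fin mulr_ge0 ?powR_ge0.
apply: ae_ge0_le_integral => //.
- by move=> x _; rewrite -EFinM lee_fin !mulr_ge0 ?powR_ge0.
- apply: emeasurable_funM => //.
  by have := mpow 1; under eq_fun do rewrite mul1r.
- by move=> x _; apply: integral_ge0.
- exact: measurable_fun_fubini_tonelli_G.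
apply: (@filterS _ _ FF _ _ _ xk) => x h _.
have msec : measurable [set theta : borelRV R d | separated (theta, x)].
  rewrite -[X in measurable X]setTI.
  exact: (mpair x measurableT _ measurable_separated).
have -> : (\int[sigma]_theta F (theta, x) =
    ((t * delta x) `^ p)%:E * sigma [set theta | separated (theta, x)])%E.
  rewrite /F /= ge0_integralZl//; last 2 first.
  - apply/measurable_EFinP; apply: (measurableT_comp _ (mpair x)).
    by apply: measurable_indic; exact: measurable_separated.
  - by rewrite lee_fin powR_ge0.
  congr (_ * _)%E; rewrite -[X in sigma X]setIT -integral_indic//.
(* Where [delta x] vanishes, both sides are [0], as [p] is nonzero. *)
have := dist_set_ge0 x Y; rewrite -/(delta x) le_eqVlt => /orP[/eqP<-|dx].
  by rewrite mulr0 powR0 ?mule0 ?mul0e// lt0r_neq0.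
rewrite (powRM _ (ltW t0) (ltW dx)) -EFinM -mulrA mulrC EFinM.
apply: lee_wpmul2l; first by rewrite lee_fin mulr_ge0 ?powR_ge0.
by apply: separated_section_ge => //; exact: h.
Qed.

End comparison.

Theorem theorem1p3 (R : realType) :
  exists C : R, 0 < C /\
  forall (p : R) (d : nat), 1 <= p -> (2 <= d)%N ->
  forall (sigma : probability (borelRV R d) R), uniform_on_sphere sigma ->
  forall (mu nu : probability (borelRV R d) R),
    (\int[mu]_x ((enorm x) `^ p)%:E < +oo)%E ->
    countable (msupport nu) ->
    (exists gamma : probability (borelRV R d * borelRV R d)%type R,
       coupling mu nu gamma /\
       {ae gamma, forall z, enorm (z.1 - z.2 : 'rV[R]_d) =
                            dist_set z.1 (msupport nu)}) ->
    (Kparam mu nu < +oo)%E ->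
    (Wp p mu nu <= (C * Num.sqrt d%:R)%:E * Kparam mu nu * SW sigma p mu nu)%E.
Proof.
(* The constant is [2 * 12]: the [12] comes from [t], and the [2] from the half of the directions
   that are kept. *)
exists 24; split=> // p d p1 d2 sigma sigmaU mu nu _ cY [gamma [gc gY]] Koo.
have p0 : 0 < p by exact: lt_le_trans p1.
have sd0 : 0 < Num.sqrt d%:R :> R by rewrite sqrtr_gt0 ltr0n (leq_trans _ d2).
have [k [-> k0 kY]] := Kparam_ae cY Koo.
pose X : \bar R := (\int[mu]_x ((dist_set x (msupport nu)) `^ p)%:E)%E.
have X0 : (0 <= X)%E.
  by apply: integral_ge0 => x _; rewrite lee_fin powR_ge0.
have mpow : measurable_fun setT
    (fun x : borelRV R d => ((dist_set x (msupport nu)) `^ p)%:E).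
  apply/measurable_EFinP; apply: (measurableT_comp (measurable_powR p)).
  by apply: measurable_dist_set => //; exact: msupport_neq0.
have WX : (Wp p mu nu <= X `^ p^-1)%E.
  apply: (le_trans (Wasserstein_le _ p1 gc)).
  rewrite le_eqVlt; apply/orP; left; apply/eqP; congr (_ `^ _)%E.
  have -> : X = (\int[gamma]_z ((dist_set z.1 (msupport nu)) `^ p)%:E)%E.
    rewrite -[LHS](@ge0_integral_image _ _ _ _ _ _ _ _ _ gamma mu
      (fun x : borelRV R d => ((dist_set x (msupport nu)) `^ p)%:E)
      measurable_fst (@measurable_id _ _ setT))//.
    - by move=> A mA; rewrite (gc A mA).1.
    - by move=> x; rewrite lee_fin powR_ge0.
  apply: ae_eq_integral => //.
  - apply/measurable_EFinP; apply: (measurableT_comp (measurable_powR p)).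
    apply: measurable_fun_enorm.
    by apply: measurable_fun_subrv; [exact: measurable_fst|exact: measurable_snd].
  - exact: (measurableT_comp mpow measurable_fst).
  have FF := ae_filter_ringOfSetsType gamma.
  by apply: (@filterS _ _ FF _ _ _ gY) => z zY _; rewrite zY.
have SW0 : (0 <= SW sigma p mu nu)%E by exact: poweR_ge0.
apply: (le_trans WX).
have FF := ae_filter_ringOfSetsType mu.
(* If [k = 0], the distance to the support vanishes almost everywhere, so [X = 0]. *)
move: k0; rewrite le_eqVlt => /orP[/eqP k0|k0].
  have -> : X = 0%E.
    rewrite /X (ae_eq_integral (cst 0%E)) ?integral0//.
    apply: (@filterS _ _ FF _ _ _ kY) => x kx _ /=.
    have := dist_set_ge0 x (msupport nu); rewrite le_eqVlt => /orP[/eqP<-|dx].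
      by rewrite powR0// lt0r_neq0.
    by have [] := kx dx; rewrite -k0 ltxx.
  by rewrite poweR0r ?invr_eq0 ?lt0r_neq0// mule_ge0// -k0 mule0.
have kY' : {ae mu, forall x, 0 < dist_set x (msupport nu) ->
    ((dist_set x (msupport nu))%:E *
     (\esum_(y in msupport nu) ((enorm ((x : 'rV[R]_d) - y))^-1)%:E) <= k%:E)%E}.
  by apply: (@filterS _ _ FF _ _ _ kY) => x kx /kx[].
have := sliced_integral_ge cY sigmaU k0 p1 sd0 kY'.
rewrite /SW; set Z := (X in (_ <= X)%E); rewrite -/X => XZ.
set t := (12 * Num.sqrt d%:R * k)^-1 in XZ.
have t0 : 0 < t by rewrite invr_gt0 !mulr_gt0.
have Z0 : (0 <= Z)%E by apply: integral_ge0 => theta _; exact: poweR_ge0.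
have tp0 : 0 < t `^ p by rewrite powR_gt0.
(* Since [2 <= 2 ^ p] for [p >= 1], the factor [2 / t ^ p] is at most [(2 / t) ^ p]. Its [p]-th root
   [2 / t = 24 * sqrt d * k] then carries a constant independent of [p]. *)
have XZ' : (X <= ((2 / t) `^ p)%:E * Z)%E.
  apply: (@le_trans _ _ ((2 / t `^ p)%:E * ((2^-1 * t `^ p)%:E * X))%E).
    rewrite muleA -EFinM.
    have -> : 2 / t `^ p * (2^-1 * t `^ p) = 1 by field; exact: lt0r_neq0.
    by rewrite mul1e.
  apply: (@le_trans _ _ ((2 / t `^ p)%:E * Z)%E).
    by apply: lee_wpmul2l => //; rewrite lee_fin divr_ge0// ltW.
  apply: lee_wpmul2r => //; rewrite lee_fin.
  have tV0 : 0 <= t^-1 by rewrite invr_ge0 ltW.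
  have tV : t^-1 `^ p = (t `^ p)^-1.
    apply: (mulfI (lt0r_neq0 tp0)); rewrite -(powRM _ (ltW t0) tV0).
    by rewrite !divff ?powR1// lt0r_neq0.
  rewrite (powRM _ _ tV0)// tV.
  rewrite ler_wpM2r ?invr_ge0 ?powR_ge0//.
  by rewrite -[leLHS]powRr1// ler_powR// ler1n.
have -> : ((24 * Num.sqrt d%:R)%:E * k%:E * Z `^ p^-1 =
    (((2 / t) `^ p)%:E * Z) `^ p^-1)%E.
  rewrite poweRM ?lee_fin ?powR_ge0// poweR_EFin -powRrM mulfV ?lt0r_neq0//.
  rewrite powRr1 ?divr_ge0 ?(ltW t0)// -EFinM /t invrK.
  by congr (_%:E * _)%E; ring.
apply: gt0_ler_poweR => //.
- by rewrite invr_ge0 ltW.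
- by rewrite in_itv/= X0 leey.
- by rewrite in_itv/= leey andbT mule_ge0// lee_fin powR_ge0.
Qed.
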